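(* The set of sentences of the well-formed fragment of finitary hybrid $\mathrm{CTL}^*_{lp}$ has the same expressiveness as finitary $\mathrm{CTL}^*$: every such sentence is equivalent to a finitary $\mathrm{CTL}^*$ formula and vice versa, where two formulas are equivalent if they have the same finite Kripke structures as models.
   Context: A Kripke structure over a finite set $\mathcal{AP}$ is $K=(\mathcal{AP},S,\delta,\mu,s_0)$ with states $S$, left-total $\delta\subseteq S\times S$, labelling $\mu:S\to2^{\mathcal{AP}}$, initial state $s_0$; finite if $S$ is finite. A trace is a non-empty finite prefix of an infinite state sequence following $\delta$; initial if it starts at $s_0$. Finitary $\mathrm{CTL}^*$: $\varphi::=\top\mid p\mid\neg\varphi\mid\varphi\wedge\varphi\mid\mathsf X\varphi\mid\varphi\mathsf U\varphi\mid\exists_f\varphi$ interpreted at positions $i$ of traces $\rho$: $\rho,i\models\mathsf X\varphi$ iff $i+1<|\rho|$ and $\rho,i+1\models\varphi$; until restricted to positions of $\rho$; $\rho,i\models\exists_f\varphi$ iff some trace $\rho'$ starting at $\rho(i)$ has $\rho',0\models\varphi$; $K$ is a model iff $\rho,0\models\varphi$ for every initial trace $\rho$. Finitary hybrid $\mathrm{CTL}^*_{lp}$: with position variables, $\varphi::=\top\mid p\mid x\mid\neg\varphi\mid\varphi\vee\varphi\mid{\downarrow}x.\varphi\mid\mathsf X\varphi\mid\varphi\mathsf U\varphi\mid\mathsf X^-\varphi\mid\varphi\mathsf U^-\varphi\mid\exists_f\varphi$, interpreted on an initial trace $\rho$, valuation $g$ of variables to positions, position $i$: $x$ iff $g(x)=i$;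 ${\downarrow}x.\varphi$ iff $\rho,g[x\leftarrow i],i\models\varphi$; $\mathsf X\varphi$ iff $i+1<|\rho|$ and $\rho,g,i+1\models\varphi$; $\mathsf U$ restricted to positions of $\rho$; $\mathsf X^-\varphi$ iff $i>0$ and $\rho,g,i-1\models\varphi$; $\varphi_1\mathsf U^-\varphi_2$ iff some $j\le i$ has $\varphi_2$ at $j$ and $\varphi_1$ at all $j<k\le i$; $\exists_f\varphi$ iff some initial trace $\rho'$ with $\rho'[0,i]=\rho[0,i]$ has $\rho',g,i\models\varphi$. $\mathsf F^-\varphi:=\top\mathsf U^-\varphi$. $K$ is a model of $\varphi$ iff $\rho,g_0,0\models\varphi$ for every initial trace $\rho$, $g_0$ assigning $0$ to every variable. Well-formed: every subformula $\exists_f\psi$ has at most one free variable, and every subformula $\exists_f\psi(x)$ with free variable $x$ occurs in the context $(\mathsf F^-x)\wedge\exists_f\psi(x)$. A sentence has no free variables. *)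

(* Defs.v *)
From mathcomp Require Import all_boot.
Set Implicit Arguments.
Unset Strict Implicit.
Unset Printing Implicit Defensive.

Record kripke (AP : finType) := Kripke {
  kst : finType;
  kdelta : rel kst;
  kmu : kst -> {set AP};
  ks0 : kst;
  kdelta_total : forall s, exists t, kdelta s t
}.

Section Traces.
Variables (AP : finType) (K : kripke AP).

Definition inf_path (f : nat -> kst K) : Prop :=
  forall n, kdelta (f n) (f n.+1).

Definition trace (rho : seq (kst K)) : Prop :=
  0 < size rho /\ exists f, inf_path f /\ rho = mkseq f (size rho).

Definition at_pos (rho : seq (kst K)) (i : nat) : kst K := nth (ks0 K) rho i.

Definition initial_trace (rho : seq (kst K)) : Prop :=
  trace rho /\ at_pos rho 0 = ks0 K.
End Traces.

Inductive cform (AP : Type) :=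
| CTop
| CAtom of AP
| CNot of cform AP
| CAnd of cform AP & cform AP
| CX of cform AP
| CU of cform AP & cform AP
| CEf of cform AP.

Fixpoint csat (AP : finType) (K : kripke AP) (rho : seq (kst K)) (i : nat)
  (phi : cform AP) {struct phi} : Prop :=
  match phi with
  | CTop => True
  | CAtom p => p \in kmu (at_pos rho i)
  | CNot a => ~ csat rho i a
  | CAnd a b => csat rho i a /\ csat rho i b
  | CX a => i.+1 < size rho /\ csat rho i.+1 a
  | CU a b => exists j, [/\ i <= j, j < size rho, csat rho j b &
                          forall k, i <= k -> k < j -> csat rho k a]
  | CEf a => exists rho' : seq (kst K),
               [/\ trace rho', at_pos rho' 0 = at_pos rho i & csat rho' 0 a]
  end.

Definition cmodel (AP : finType) (K : kripke AP) (phi : cform AP) : Prop :=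
  forall rho : seq (kst K), initial_trace rho -> csat rho 0 phi.

Inductive hform (AP : Type) :=
| HTop
| HAtom of AP
| HVar of nat
| HNot of hform AP
| HOr of hform AP & hform AP
| HBind of nat & hform AP
| HX of hform AP
| HU of hform AP & hform AP
| HXm of hform AP
| HUm of hform AP & hform AP
| HEf of hform AP.

Fixpoint hsat (AP : finType) (K : kripke AP) (rho : seq (kst K))
  (g : nat -> nat) (i : nat) (phi : hform AP) {struct phi} : Prop :=
  match phi with
  | HTop => True
  | HAtom p => p \in kmu (at_pos rho i)
  | HVar x => g x = i
  | HNot a => ~ hsat rho g i a
  | HOr a b => hsat rho g i a \/ hsat rho g i b
  | HBind x a => hsat rho (fun y => if y == x then i else g y) i a
  | HX a => i.+1 < size rho /\ hsat rho g i.+1 a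
  | HU a b => exists j, [/\ i <= j, j < size rho, hsat rho g j b &
                          forall k, i <= k -> k < j -> hsat rho g k a]
  | HXm a => 0 < i /\ hsat rho g i.-1 a
  | HUm a b => exists j, [/\ j <= i, hsat rho g j b &
                          forall k, j < k -> k <= i -> hsat rho g k a]
  | HEf a => exists rho' : seq (kst K),
               [/\ initial_trace rho', take i.+1 rho' = take i.+1 rho
                 & hsat rho' g i a]
  end.

Definition hmodel (AP : finType) (K : kripke AP) (phi : hform AP) : Prop :=
  forall rho : seq (kst K), initial_trace rho -> hsat rho (fun _ => 0) 0 phi.

Definition hAnd (AP : Type) (a b : hform AP) : hform AP :=
  HNot (HOr (HNot a) (HNot b)).
Definition hFm (AP : Type) (a : hform AP) : hform AP := HUm (HTop AP) a.

Fixpoint fv (AP : Type) (phi : hform AP) : seq nat :=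
  match phi with
  | HTop | HAtom _ => [::]
  | HVar x => [:: x]
  | HNot a | HX a | HXm a | HEf a => fv a
  | HOr a b | HU a b | HUm a b => fv a ++ fv b
  | HBind x a => [seq y <- fv a | y != x]
  end.

Definition sentence (AP : Type) (phi : hform AP) : bool := nilp (fv phi).

(* Well-formedness: every subformula E_f psi has at most one free variable,
   and an occurrence E_f psi(x) with free variable x must occur in the
   context (F^- x) /\ E_f psi(x), i.e. as the right conjunct of
   hAnd (hFm (HVar x)) (HEf psi). *)
Fixpoint wf (AP : Type) (phi : hform AP) : bool :=
  match phi with
  | HNot (HOr (HNot (HUm HTop (HVar x))) (HNot (HEf psi))) =>
      all (pred1 x) (fv psi) && wf psi
  | HEf psi => nilp (fv psi) && wf psi
  | HTop | HAtom _ | HVar _ => true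
  | HNot a | HX a | HXm a | HBind _ a => wf a
  | HOr a b | HU a b | HUm a b => wf a && wf b
  end.

(* Main.v *)
(* A linear hybrid formula is a first-order condition on a word with marked positions, so the words
   satisfying it are recognised by a finite aperiodic monoid: quantifying over a position is the
   Schützenberger product.  At a quantifier E_f taken at position i, all marks lie at or before i;
   the value of the word in the monoid factors as (value up to i) * (value of the unmarked rest),
   and the existence of a continuation with a given value is a property of the current state.
   It is a CTL* state formula because languages recognised by finite aperiodic monoids are
   definable in linear temporal logic, which is proved by induction with the local divisors
   cM /\ Mc of Diekert and Gastin.  Adding these state formulas to the alphabet, one eliminates
   the quantifiers E_f from the inside out. *)
From mathcomp Require Import all_boot boolp zify.
Require Import Defs.
Set Implicit Arguments.
Unset Strict Implicit.
Unset Printing Implicit Defensive.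

(** * Temporal languages of finite words *)

Section TemporalLanguages.
Variable A : finType.
Implicit Types (P : pred A) (L : seq A -> Prop) (w : seq A).

Definition head_in P w : Prop := if w is a :: _ then P a else False.

(* The empty word counts as a suffix, unlike in [CX] and [CU]. *)
Definition next L w : Prop := if w is _ :: v then L v else False.

Fixpoint until L1 L2 w : Prop :=
  if w is _ :: v then L2 w \/ (L1 w /\ until L1 L2 v) else L2 w.

(** Formulas are represented by the languages they define, so equivalent formulas are equal. *)
Inductive ltl : (seq A -> Prop) -> Prop :=
| ltl_head P : ltl (head_in P)
| ltl_not L : ltl L -> ltl (fun w => ~ L w)
| ltl_and L1 L2 : ltl L1 -> ltl L2 -> ltl (fun w => L1 w /\ L2 w)
| ltl_next L : ltl L -> ltl (next L)
| ltl_until L1 L2 : ltl L1 -> ltl L2 -> ltl (until L1 L2).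

Lemma ltl_ext L L' : (forall w, L w <-> L' w) -> ltl L -> ltl L'.
Proof. by move=> e; have -> : L = L' by apply: funext => w; apply: propext. Qed.

Lemma ltl_or L1 L2 : ltl L1 -> ltl L2 -> ltl (fun w => L1 w \/ L2 w).
Proof.
move=> l1 l2; apply: ltl_ext (ltl_not (ltl_and (ltl_not l1) (ltl_not l2))) => w.
by split=> [/not_andP[] /contrapT|[h|h] []]; [left|right|..].
Qed.

Lemma ltl_false : ltl (fun=> False).
Proof. by apply: ltl_ext (ltl_head pred0) => -[]. Qed.

Lemma ltl_const (Q : Prop) : ltl (fun=> Q).
Proof.
have [q|nq] := pselect Q; last by apply: ltl_ext ltl_false.
by apply: ltl_ext (ltl_not ltl_false) => w; split=> // _ [].
Qed.

Lemma ltl_exists (I : finType) (L : I -> seq A -> Prop) :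
  (forall i, ltl (L i)) -> ltl (fun w => exists i, L i w).
Proof.
move=> lL; have h (s : seq I) : ltl (fun w => exists2 i, i \in s & L i w).
  elim: s => [|i s IH]; first by apply: ltl_ext ltl_false => w; split=> // -[].
  apply: ltl_ext (ltl_or (lL i) IH) => w; split.
    by case=> [Li|[j js Lj]]; [exists i|exists j]; rewrite // inE ?eqxx ?js ?orbT.
  by case=> j; rewrite inE => /orP[/eqP->|js] Lj; [left|right; exists j].
apply: ltl_ext (h (enum I)) => w; split=> -[i]; first by exists i.
by exists i; rewrite ?mem_enum.
Qed.

Lemma ltl_all (B : {set A}) : ltl (fun w => all (mem B) w).
Proof.
apply: ltl_ext (ltl_not (ltl_until (ltl_const True) (ltl_head (predC (mem B))))).
elim=> [|a w IH] /=; first by split=> // _ [].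
split=> [h|/andP[aB wB] [/negP//|[_]]]; last exact/IH.
apply/andP; split; first by apply: contrapT => /negP ?; apply: h; left.
by apply/IH => ?; apply: h; right.
Qed.

End TemporalLanguages.

(** * Aperiodic monoids and local divisors *)

Definition mpow (M : Type) (op : M -> M -> M) (e x : M) n := iter n (op x) e.

Definition mprod (M A : Type) (op : M -> M -> M) (e : M) (f : A -> M) w :=
  foldr (fun a => op (f a)) e w.

(* The carrier is a subset of an ambient type, so that local divisors stay inside [M]. *)
Record aperiodic_monoid (M : finType) (S : {set M}) (op : M -> M -> M) (e : M) :
  Prop := AperiodicMonoid {
  am1 : e \in S;
  amM : {in S &, forall x y, op x y \in S};
  amA : {in S & &, forall x y z, op x (op y z) = op (op x y) z};
  am1l : {in S, forall x, op e x = x};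
  am1r : {in S, forall x, op x e = x};
  am_aper : {in S, forall x, exists n, mpow op e x n = mpow op e x n.+1}
}.

Section Monoid.
Variables (M : finType) (S : {set M}) (op : M -> M -> M) (e : M).
Hypothesis am : aperiodic_monoid S op e.

Lemma mpow_in x n : x \in S -> mpow op e x n \in S.
Proof. by move=> xS; elim: n => [|n IH] /=; rewrite ?(am1 am) ?(amM am). Qed.

Lemma mprod_in (A : eqType) (f : A -> M) (w : seq A) :
  {in w, forall a, f a \in S} -> mprod op e f w \in S.
Proof.
elim: w => [|a w IH] fS /=; first exact: am1 am.
apply: (amM am); first by rewrite fS ?mem_head.
by apply: IH => b bw; rewrite fS // inE bw orbT.
Qed.

Lemma mprod_unit (A : eqType) (f : A -> M) (w : seq A) :
  {in w, forall a, f a = e} -> mprod op e f w = e.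
Proof.
elim: w => [//|a w IH] fe /=; rewrite fe ?mem_head // IH ?(am1l am) ?(am1 am) //.
by move=> b bw; rewrite fe // inE bw orbT.
Qed.

Variable c : M.
Hypothesis cS : c \in S.

Definition divisor : {set M} :=
  [set x in S | [exists y in S, x == op c y] && [exists y in S, x == op y c]].

(** Division by [c] is ambiguous, but harmlessly so in [divop]: there the right factor is a multiple
    [c y'], and [z c y'] depends on [z c] only. The default [e] is not reached on [divisor]. *)
Definition unshift x := odflt e [pick y in S | op y c == x].

Definition divop x y := op (unshift x) y.

Lemma divisorP x : x \in divisor ->
  [/\ x \in S, exists2 y, y \in S & x = op c y & exists2 y, y \in S & x = op y c].
Proof.
rewrite inE => /andP[xS /andP[/exists_inP[y yS /eqP xy] /exists_inP[z zS /eqP xz]]].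
by split=> //; [exists y|exists z].
Qed.

Lemma divisorI x y z : y \in S -> z \in S -> x = op c y -> x = op z c -> x \in divisor.
Proof.
move=> yS zS xy xz; rewrite inE {1}xy (amM am) //=; apply/andP.
by split; apply/exists_inP; [exists y|exists z] => //; apply/eqP.
Qed.

Lemma divopE x y : x \in S -> y \in divisor -> divop (op x c) y = op x y.
Proof.
move=> xS /divisorP[_ [y' yS ->] _]; rewrite /divop /unshift.
case: pickP => [z /andP[zS /eqP zc]|/(_ x)] /=; last by rewrite xS eqxx.
by rewrite !(amA am) // zc.
Qed.

Lemma divisor_monoid : aperiodic_monoid divisor divop c.
Proof.
have cD : c \in divisor.
  by apply: (divisorI (am1 am) (am1 am)); rewrite ?(am1r am) ?(am1l am).
have dM : {in divisor &, forall x y, divop x y \in divisor}.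
  move=> x y xD yD; have [xS [x1 x1S x1E] [x2 x2S x2E]] := divisorP xD.
  have [yS [y1 y1S y1E] [y2 y2S y2E]] := divisorP yD.
  rewrite {1}x2E divopE //; apply: (divisorI (amM am x1S y1S) (amM am x2S y2S)).
    by rewrite y1E !(amA am) // -x2E x1E.
  by rewrite y2E !(amA am).
split=> //.
- move=> x y z xD yD zD; have [_ _ [x' x'S ->]] := divisorP xD.
  have [yS _ [y' y'S yE]] := divisorP yD; have [zS _ _] := divisorP zD.
  rewrite divopE ?dM // (divopE x'S yD) [in RHS]yE (amA am) // [RHS]divopE ?(amM am) //.
  by rewrite [in LHS]yE divopE // (amA am).
- move=> x xD; have [xS _ _] := divisorP xD.
  by rewrite -{1}(am1l am cS) divopE ?(am1l am) ?(am1 am).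
- by move=> x /divisorP[xS _ [x' x'S ->]]; rewrite divopE.
- move=> x xD; have [xS _ [x' x'S xE]] := divisorP xD.
  (* The powers of [x' c] in the local divisor are [x'^n c], so they stabilise with those of
     [x']. *)
  have h n : mpow divop c x n = op (mpow op e x' n) c
             /\ mpow divop c x n \in divisor.
    elim: n => [|n [IH IHD]] /=; first by rewrite (am1l am).
    split; last exact: dM.
    by rewrite [X in divop X]xE divopE // IH (amA am) // mpow_in.
  by have [n e_n] := am_aper am x'S; exists n; rewrite !(h _).1 e_n.
Qed.

(** The unit is not in the divisor: from [e = y c] one could cancel [c] in [c^n = c^(n+1)] down to
    [c = e]. *)
Lemma divisor_card : c != e -> #|divisor| < #|S|.
Proof.
move=> ce; apply: proper_card; apply/properP; split.
  by apply/subsetP => x /divisorP[].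
exists e; first exact: am1 am.
apply/negP => /divisorP[_ _ [y yS ey]]; case/eqP: ce.
have [n] := am_aper am cS; elim: n => [|n IH] /=; first by rewrite (am1r am).
move=> /(congr1 (op y)); rewrite !(amA am) ?(amM am) ?mpow_in // -ey.
by rewrite !(am1l am) ?(amM am) ?mpow_in.
Qed.

End Monoid.

(** * Relativising a temporal language to the prefix before a fixed letter *)

Section Prefix.
Variables (A : finType) (c : A).
Implicit Types (L : seq A -> Prop) (w : seq A).

(** Reading a letter replaces [L] by its residual, so Boolean operations commute with [before] by
    plain induction. *)
Fixpoint before L w : Prop :=
  if w is a :: v then if a == c then L [::] else before (fun u => L (a :: u)) v
  else False.

Lemma beforeP L w :
  before L w <-> exists u v, [/\ w = u ++ c :: v, c \notin u & L u].
Proof.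
elim: w L => [|a w IH] L /=; first by split=> // -[[|? ?] [? []]].
case: eqP => [->|/eqP ac]; split.
- by move=> L0; exists [::], w.
- by case=> -[|b u] [v []] //= [<- _]; rewrite inE eqxx.
- move/IH=> [u [v [-> cu Lu]]]; exists (a :: u), v.
  by rewrite inE negb_or cu eq_sym ac.
- case=> -[|b u] [v []] /= [e]; first by rewrite e eqxx in ac.
  move=> wE; rewrite inE negb_or -e => /andP[_ cu] Lu; apply/IH.
  by exists u, v.
Qed.

Lemma first_occurrence w :
  c \in w -> exists u v, w = u ++ c :: v /\ c \notin u.
Proof.
elim: w => [//|a w IH]; rewrite inE; case: (c =P a) => [<- _|/eqP ca /= /IH].
  by exists [::], w.
by case=> u [v [-> cu]]; exists (a :: u), v; rewrite inE negb_or ca.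
Qed.

Lemma before_not L w :
  before (fun u => ~ L u) w <-> before (fun=> True) w /\ ~ before L w.
Proof.
elim: w L => [|a w IH] L /=; first by split=> // -[].
by case: eqP => // _; split=> // -[].
Qed.

Lemma before_and L1 L2 w :
  before (fun u => L1 u /\ L2 u) w <-> before L1 w /\ before L2 w.
Proof.
elim: w L1 L2 => [|a w IH] L1 L2 /=; first by split=> // -[].
by case: eqP.
Qed.

Lemma before_or L1 L2 w :
  before (fun u => L1 u \/ L2 u) w <-> before L1 w \/ before L2 w.
Proof.
elim: w L1 L2 => [|a w IH] L1 L2 /=; first by split=> // -[].
by case: eqP.
Qed.

Lemma before_const (Q : Prop) w :
  before (fun=> Q) w <-> Q /\ before (fun=> True) w.
Proof.
elim: w => [|a w IH] /=; first by split=> // -[].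
by case: eqP => // _; split=> // -[].
Qed.

(** Induction on the formula for [L]: each operator is relativised to the positions before the first
    [c], and a negation is conjoined with the occurrence of a [c]. *)
Lemma ltl_before L : ltl L -> ltl (before L).
Proof.
have lT : ltl (before (fun=> True)).
  apply: ltl_ext (ltl_until (ltl_const A True) (ltl_head (pred1 c))).
  elim=> [//|a w IH] /=; case: eqP => _; first by split=> // _; left.
  by split=> [[//|[_ /IH]]|/IH h]; last by right.
have lc : ltl (head_in (predC1 c)) by apply: ltl_head.
elim=> {L} [P|L _ lL|L1 L2 _ l1 _ l2|L _ lL|L1 L2 _ l1 _ l2].
- apply: ltl_ext (ltl_and (ltl_and lc (ltl_head P)) lT) => -[|a w] /=.
    by split=> // -[[]].
  case: eqP => _ /=; first by split=> // -[[]].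
  by rewrite (before_const (P a)); split=> [[[]]|[]].
- by apply: ltl_ext (ltl_and lT (ltl_not lL)) => w; rewrite before_not.
- by apply: ltl_ext (ltl_and l1 l2) => w; rewrite before_and.
- apply: ltl_ext (ltl_and lc (ltl_next lL)) => -[|a w] /=; first by split=> // -[].
  by case: eqP => _ /=; split=> // -[].
- apply: ltl_ext (ltl_until (ltl_and lc l1) l2); elim=> [|a w IH] //=.
  case: eqP => _ /=; first by split=> [[//|[[]]]|]; [|left].
  rewrite before_or before_and -IH; split.
    by case=> [|[[]]]; [left|right].
  by case=> [|[]]; [left|right].
Qed.

End Prefix.

(** * Languages recognised by aperiodic monoids are temporal *)

Section Blocks.
Variables (A : finType) (M : finType) (S : {set M}) (op : M -> M -> M) (e : M).
Hypothesis am : aperiodic_monoid S op e.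
Variables (f : A -> M) (B : {set A}) (c : A).
Hypotheses (fS : {in B, forall a, f a \in S}) (cB : c \in B).
Implicit Types w : seq A.

(* [w = u1 c u2 c .. c uk] is sent to the values of [u1], .., [u(k-1)]. *)
Fixpoint blocks w : seq M :=
  if w is a :: v then
    if a == c then e :: blocks v
    else if blocks v is t :: l then op (f a) t :: l else [::]
  else [::].

(** The value of [uk]: a letter contributes only if no [c] occurs in the suffix that it begins. *)
Fixpoint last_block w : M :=
  if w is a :: v then
    if c \in w then last_block v else op (f a) (last_block v)
  else e.

Lemma blocks_nil w : (blocks w == [::]) = (c \notin w).
Proof.
elim: w => [//|a w IH] /=; rewrite inE negb_or (eq_sym c); case: (a =P c) => //= _.
by rewrite -IH; case: (blocks w).
Qed.

Lemma blocks_cat u v :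
  c \notin u -> blocks (u ++ c :: v) = mprod op e f u :: blocks v.
Proof.
elim: u => [_|a u IH] /=; first by rewrite eqxx.
by rewrite inE negb_or eq_sym => /andP[/negPf-> /IH ->].
Qed.

Lemma last_block_mprod w : c \notin w -> last_block w = mprod op e f w.
Proof.
elim: w => [//|a w IH] cw /=; rewrite (negPf cw) IH //.
by move: cw; rewrite inE negb_or => /andP[].
Qed.

Lemma last_block_in w : all (mem B) w -> last_block w \in S.
Proof.
elim: w => [_|a w IH] /=; first exact: am1 am.
case/andP=> aB /IH lw; case: ifP => // _; exact: (amM am (fS aB)).
Qed.

Lemma blocks_in w : all (mem B) w -> all (mem S) (blocks w).
Proof.
elim: w => [//|a w IH] /= /andP[aB /IH]; case: ifP => _.
  by rewrite /= (am1 am).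
by case: (blocks w) => //= t l /andP[tS ->]; rewrite (amM am) ?fS.
Qed.

(** Writing [c] for [f c], the local divisor multiplies [c t c] and [c t' c] to [c t c t' c]. So
    [div_prod] is the value in [M] of [c t1 c .. tk c], which is [c] for the empty list. *)
Let shift t := op (op (f c) t) (f c).
Let div_prod := mprod (divop S op e (f c)) (f c) shift.

Lemma shift_in t : t \in S -> shift t \in divisor S op (f c).
Proof.
move=> tS; have cS := fS cB.
by apply: (divisorI am cS (y := op t (f c)) (z := op (f c) t));
  rewrite ?(amM am) ?(amA am).
Qed.

Lemma div_prod_in l : all (mem S) l -> div_prod l \in divisor S op (f c).
Proof.
move=> /allP lS; apply: (mprod_in (divisor_monoid am (fS cB))) => t /lS.
exact: shift_in.
Qed.

(** Cut at the first and the last [c]: the middle factor, which includes both, is the product of the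
    inner blocks in the local divisor. *)
Lemma mprod_blocks w : all (mem B) w ->
  mprod op e f w =
    if blocks w is t :: l then op (op t (div_prod l)) (last_block w)
    else last_block w.
Proof.
have cS := fS cB.
have dS l : all (mem S) l -> div_prod l \in S.
  by move=> /div_prod_in /divisorP[].
elim: w => [//|a w IH] /= /andP[aB wB]; rewrite IH //.
have := blocks_in wB; have := last_block_in wB.
have := blocks_nil w; rewrite inE (eq_sym c); case: (blocks w) => [|t l].
  rewrite eqxx => /esym cw lwS _; rewrite (negPf cw) orbF; case: eqP => // ->.
  by rewrite /div_prod /= (am1l am).
move=> /esym /negbFE -> lwS /= /andP[tS lS]; rewrite orbT; case: eqP => [->|_].
  rewrite {2}/div_prod /= -/(div_prod l).
  rewrite divopE ?(amM am) ?div_prod_in // (am1l am) ?(amM am) ?dS //.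
  by rewrite !(amA am) ?(amM am) ?dS.
by rewrite !(amA am) ?(amM am) ?dS ?fS.
Qed.

Hypothesis IHB : forall m,
  ltl (fun w => all (mem (B :\ c)) w /\ mprod op e f w = m).

Lemma all_setD1 w : all (mem (B :\ c)) w = all (mem B) w && (c \notin w).
Proof.
elim: w => [//|a w IH] /=; rewrite IH !inE negb_or (eq_sym c).
by case: (a == c); rewrite ?andbF //= -!andbA; do !bool_congr.
Qed.

Let lc : ltl (head_in (pred1 c)) := ltl_head (pred1 c).

(* The suffixes of [blocks w] are the [blocks] of [w] and of its suffixes following a [c]. *)
Lemma ltl_blocks Q : ltl Q ->
  exists2 L, ltl L & forall w, all (mem B) w -> L w <-> Q (blocks w).
Proof.
elim=> {Q} [P|Q _ [L lL LQ]|Q1 Q2 _ [L1 l1 LQ1] _ [L2 l2 LQ2]|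
  Q _ [L lL LQ]|Q1 Q2 _ [L1 l1 LQ1] _ [L2 l2 LQ2]].
(* The first letter of [blocks w] is the value of the prefix before the first [c], to which [IHB]
   applies. *)
- pose R m u := all (mem (B :\ c)) u /\ mprod op e f u = m.
  exists (fun w => exists m, P m /\ before c (R m) w).
    by apply: ltl_exists => m; apply: ltl_and (ltl_const _ _) (ltl_before c (IHB m)).
  move=> w wB; split.
    case=> m [Pm /beforeP[u [v [-> cu [_ um]]]]].
    by rewrite blocks_cat // um.
  have := blocks_nil w; case: (boolP (c \in w)) => [|_ /eqP-> //].
  case/first_occurrence=> u [v [wE cu]] _.
  rewrite wE blocks_cat //= => Pu; exists (mprod op e f u).
  split=> //; apply/beforeP; exists u, v; split=> //; split=> //.
  by rewrite all_setD1 cu; move: wB; rewrite wE all_cat => /andP[->].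
- by exists (fun w => ~ L w) => [|w wB]; [apply: ltl_not|rewrite LQ].
- exists (fun w => L1 w /\ L2 w) => [|w wB]; first exact: ltl_and.
  by rewrite LQ1 ?LQ2.
(* The tail of [blocks w] belongs to the suffix after the first [c]. *)
- exists (until (head_in (predC1 c)) (fun w => head_in (pred1 c) w /\ next L w)).
    by apply: ltl_until; [apply: ltl_head|apply: ltl_and; last exact: ltl_next].
  elim=> [_|a w IH] /=; first by split=> // -[].
  case/andP=> aB wB; case: (a =P c) => _ /=; first by rewrite LQ //; split=> [[[]|[]]|] //; left.
  have {}IH := IH wB; split.
    by case=> [[]//|[_ /IH]]; case: (blocks w).
  by move=> h; right; split=> //; apply/IH; move: h; case: (blocks w).
(* [N] expresses the until on the tail of [blocks w]: [L1] holds after each [c] passed, until [L2]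
   holds after some [c]. The word [w] itself, which follows no [c], is treated separately. *)
- pose N := until (fun w => head_in (pred1 c) w -> next L1 w)
                  (fun w => head_in (pred1 c) w /\ next L2 w).
  have lN : ltl N.
    apply: ltl_until; last by apply: ltl_and lc (ltl_next l2).
    apply: ltl_ext (ltl_or (ltl_not lc) (ltl_next l1)) => w; split.
      by case=> // n /n.
    by move=> h; have [cw|] := pselect (head_in (pred1 c) w); [right; apply: h|left].
  exists (fun w => L2 w \/ (L1 w /\ N w)).
    exact: ltl_or l2 (ltl_and l1 lN).
  have NE a w : N (a :: w) = ((a == c /\ L2 w) \/ ((a == c -> L1 w) /\ N w)) by [].
  have NQ w : all (mem B) w -> N w <-> next (until Q1 Q2) (blocks w).
    elim: w => [_|a w IH] /=; first by split=> // -[].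
    case/andP=> aB wB; rewrite NE; case: (a =P c) => _ /=.
      rewrite LQ1 ?LQ2 // IH //; case: (blocks w) => [|t l] /=.
        by split=> [[[]|[_ []]]|] //; left.
      split; first by case=> [[_ ?]|[h ?]]; [left|right; split=> //; exact: h].
      by case=> [?|[]]; [left|right].
    have {}IH := IH wB; split.
      by case=> [[]//|[_ /IH]]; case: (blocks w).
    by move=> h; right; split=> //; apply/IH; move: h; case: (blocks w).
  move=> w wB; rewrite LQ1 ?LQ2 // NQ //; case: (blocks w) => [|t l] //=.
  by split=> [[|[]]|] //; left.
Qed.

(** The last [c] is the only occurrence after which just letters of [B :\ c] remain. *)
Lemma last_blockP r w : all (mem B) w -> c \in w ->
  last_block w = r <->
  until (fun=> True) (fun w => head_in (pred1 c) w /\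
    next (fun u => all (mem (B :\ c)) u /\ mprod op e f u = r) w) w.
Proof.
elim: w => [//|a w IH] /= /andP[aB wB] caw; rewrite caw.
case: (boolP (c \in w)) => cw.
  rewrite IH // all_setD1 cw andbF; split; first by right.
  by case=> [[_ []]|[]].
have ac : a = c by move: caw; rewrite inE (negPf cw) orbF => /eqP.
rewrite last_block_mprod // all_setD1 wB cw ac /=; split=> [|[[_ []]|[_ h]]] //.
  by left; rewrite eqxx.
suff : c \in w by rewrite (negPf cw).
elim: {IH wB aB caw cw} w h => [[]//|b w IH] /=.
by case=> [[/eqP-> _]|[_ /IH]]; rewrite inE ?eqxx // => ->; rewrite orbT.
Qed.

Hypothesis IHD : forall m, ltl (fun l => all (mem S) l /\ div_prod l = m).

(** Words without [c] are handled by [IHB]. Otherwise one guesses, among finitely many triples with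
    product [m], the values of the first block, of the inner blocks in the divisor and of the last
    block; each is a temporal condition. *)
Lemma ltl_mprod_step m : ltl (fun w => all (mem B) w /\ mprod op e f w = m).
Proof.
pose R p q := fun l => head_in (pred1 p) l /\
  next (fun l => all (mem S) l /\ div_prod l = q) l.
have lR p q : ltl (R p q) by apply: ltl_and (ltl_head _) (ltl_next (IHD q)).
have /choice[L LR] : forall pq : M * M, exists L,
    ltl L /\ forall w, all (mem B) w -> L w <-> R pq.1 pq.2 (blocks w).
  by move=> [p q]; have [L] := ltl_blocks (lR p q); exists L.
pose D r := until (fun=> True) (fun w => head_in (pred1 c) w /\
    next (fun u => all (mem (B :\ c)) u /\ mprod op e f u = r) w).
have lD r : ltl (D r).
  by apply: ltl_until (ltl_const _ _) (ltl_and lc (ltl_next (IHB r))).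
pose X (x : M * M * M) w := op (op x.1.1 x.1.2) x.2 = m /\ (L x.1 w /\ D x.2 w).
have lX x : ltl (X x) by apply: ltl_and (ltl_const _ _) (ltl_and (LR _).1 (lD _)).
have lcw : ltl (fun w => c \in w).
  apply: ltl_ext (ltl_until (ltl_const _ True) lc).
  elim=> [//|a w IH] /=; rewrite inE eq_sym; split.
    by case=> [->|[_ /IH->]] //; rewrite orbT.
  by case/orP=> [->|/IH]; [left|right].
apply: ltl_ext (ltl_or (IHB m) (ltl_and (ltl_and lcw (ltl_all B)) (ltl_exists lX))) => w.
rewrite all_setD1; have [wB|wB] /= := boolP (all (mem B) w); last first.
  by split=> [[[]|[[]]]|[]].
have [cw|cw] := boolP (c \in w); last first.
  by split=> [[[]|[[]]]|[_ h]] //; left.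
have bw := blocks_in wB; have mw := mprod_blocks wB.
have := blocks_nil w; rewrite cw; case bE: (blocks w) mw bw => [//|t l] mw /= /andP[tS lS] _.
split.
  case=> [[]//|[_ [[[p q] r] [/= <- [/(LR (p,q)).2 h /last_blockP <- //]]]]].
  split=> //; rewrite mw; move: (h wB) => /=; rewrite /R bE /=.
  by case=> /eqP-> [_ ->].
case=> _ hm; right; split=> //; exists ((t, div_prod l), last_block w).
split; first by rewrite /= -mw.
split; last exact/last_blockP.
by apply/(LR (t, div_prod l)).2 => //; rewrite bE /R /= eqxx.
Qed.

End Blocks.

(** Induction on the size of [S], then on that of [B]. A letter [c] with [f c != e] yields a smaller
    alphabet [B :\ c] and a smaller monoid, the local divisor at [f c]. The alphabet type varies
    too, since words of blocks are words over [M]. *)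
Theorem aperiodic_ltl (M : finType) (S : {set M}) op e (A : finType) (f : A -> M)
    (B : {set A}) m :
  aperiodic_monoid S op e -> {in B, forall a, f a \in S} ->
  ltl (fun w => all (mem B) w /\ mprod op e f w = m).
Proof.
have [n] := ubnP #|S|; elim: n => // n IHn in M S op e A f B m *.
move=> Sn am; have [k] := ubnP #|B|; elim: k => // k IHk in B m * => Bk fS.
have [/exists_inP[c cB fce]|] := boolP [exists c in B, f c != e]; last first.
  move/exists_inPn => fe; apply: ltl_ext (ltl_and (ltl_all B) (ltl_const A (e = m))).
  move=> w; split=> -[wB]; rewrite (mprod_unit am) // => a aw.
    by have := fe a (allP wB a aw); rewrite negbK => /eqP.
  by have := fe a (allP wB a aw); rewrite negbK => /eqP.
have cS := fS c cB; apply: (@ltl_mprod_step _ _ S _ _ am _ _ c) => // r.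
  apply: IHk => [|a]; first by move: Bk; rewrite (cardsD1 c) cB.
  by rewrite inE => /andP[_ /fS].
apply: (IHn _ (divisor S op (f c))).
- exact: leq_trans (divisor_card am cS fce) Sn.
- exact: divisor_monoid.
- by move=> t tS; exact: (shift_in am fS cB).
Qed.

(** * Recognisable predicates on words with marked positions *)

Lemma aperiodic_full (M : finType) (op : M -> M -> M) e :
  associative op -> left_id e op -> right_id e op ->
  (forall x, exists n, mpow op e x n = mpow op e x n.+1) ->
  aperiodic_monoid [set: M] op e.
Proof. by move=> opA op1l op1r aper; split=> // *; rewrite inE. Qed.

Lemma mpow_stable (M : Type) (op : M -> M -> M) e x n k : n <= k ->
  mpow op e x n = mpow op e x n.+1 -> mpow op e x k = mpow op e x k.+1.
Proof.
move=> /subnK <- h; elim: (k - n) => [|m IH] //.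
exact: (congr1 (op x) IH).
Qed.

(** A valuation turns a word into one over pairs of a letter and the set of marks at its position;
    [k] is the position of the first letter. Marks outside the word are never read. *)
Fixpoint run (A V M : Type) (op : M -> M -> M) (e : M) (f : A -> pred V -> M) k
    (w : seq A) (g : V -> nat) : M :=
  if w is a :: w' then op (f a (fun v => g v == k)) (run op e f k.+1 w' g) else e.

Definition recognisable (A V : Type) (P : seq A -> (V -> nat) -> Prop) : Prop :=
  exists (M : finType) (op : M -> M -> M) (e : M) (f : A -> pred V -> M) (F : pred M),
    aperiodic_monoid [set: M] op e /\ forall w g, P w g <-> F (run op e f 0 w g).

Lemma run_cat (A V : Type) (M : finType) op (e : M) (f : A -> pred V -> M) k w1 w2 g :
  aperiodic_monoid [set: M] op e ->
  run op e f k (w1 ++ w2) g = op (run op e f k w1 g) (run op e f (k + size w1) w2 g).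
Proof.
move=> am; elim: w1 k => [|a w1 IH] k /=; first by rewrite (am1l am) ?addn0 ?inE.
by rewrite IH (amA am) ?inE // addSnnS.
Qed.

Lemma run_unmarked (A V M : Type) op (e : M) (f : A -> pred V -> M) k w g :
  (forall v, g v < k) -> run op e f k w g = mprod op e (f^~ xpred0) w.
Proof.
elim: w k => [//|a w IH] k gk /=; rewrite IH => [|v]; last exact: leqW.
by congr (op (f a _) _); apply: funext => v; rewrite ltn_eqF.
Qed.

Section Closure.
Variable A : Type.

Lemma rec_ext V (P P' : seq A -> (V -> nat) -> Prop) :
  (forall w g, P w g <-> P' w g) -> recognisable P -> recognisable P'.
Proof.
move=> PP' [M [op [e [f [F [am PF]]]]]]; exists M, op, e, f, F; split=> // w g.
by rewrite -PP'.
Qed.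

Lemma rec_not V (P : seq A -> (V -> nat) -> Prop) :
  recognisable P -> recognisable (fun w g => ~ P w g).
Proof.
move=> [M [op [e [f [F [am PF]]]]]]; exists M, op, e, f, (predC F); split=> // w g.
by rewrite PF; split=> /negP.
Qed.

Lemma rec_and V (P1 P2 : seq A -> (V -> nat) -> Prop) :
  recognisable P1 -> recognisable P2 -> recognisable (fun w g => P1 w g /\ P2 w g).
Proof.
move=> [M1 [op1 [e1 [f1 [F1 [am1' PF1]]]]]] [M2 [op2 [e2 [f2 [F2 [am2 PF2]]]]]].
pose op (x y : M1 * M2) := (op1 x.1 y.1, op2 x.2 y.2).
pose f a (nu : pred V) := (f1 a nu, f2 a nu).
exists (M1 * M2)%type, op, (e1, e2), f, (fun x => F1 x.1 && F2 x.2); split.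
  apply: aperiodic_full.
  - by move=> [x1 x2] [y1 y2] [z1 z2]; rewrite /op /= (amA am1') ?(amA am2) ?inE.
  - by move=> [x1 x2]; rewrite /op /= (am1l am1') ?(am1l am2) ?inE.
  - by move=> [x1 x2]; rewrite /op /= (am1r am1') ?(am1r am2) ?inE.
  move=> [x1 x2]; have [n1 h1] := am_aper am1' (in_setT x1).
  have [n2 h2] := am_aper am2 (in_setT x2); exists (n1 + n2).
  have pE n : mpow op (e1, e2) (x1, x2) n = (mpow op1 e1 x1 n, mpow op2 e2 x2 n).
    by elim: n => [//|n /= ->].
  rewrite !pE; congr (_, _).
    by apply: mpow_stable h1; apply: leq_addr.
  by apply: mpow_stable h2; apply: leq_addl.
move=> w g; rewrite PF1 PF2.
have -> : run op (e1, e2) f 0 w g = (run op1 e1 f1 0 w g, run op2 e2 f2 0 w g).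
  by elim: w (0) => [//|a w IH] k /=; rewrite IH.
by split=> [/andP|/andP].
Qed.

Lemma rec_const V (Q : Prop) : recognisable (fun (_ : seq A) (_ : V -> nat) => Q).
Proof.
exists unit, (fun _ _ => tt), tt, (fun _ _ => tt), (fun=> `[< Q >]); split.
  by apply: aperiodic_full => [//|[]|[]|x] //; exists 0.
by move=> _ _; split=> /asboolP.
Qed.

Lemma rec_or V (P1 P2 : seq A -> (V -> nat) -> Prop) :
  recognisable P1 -> recognisable P2 -> recognisable (fun w g => P1 w g \/ P2 w g).
Proof.
move=> r1 r2; apply: rec_ext (rec_not (rec_and (rec_not r1) (rec_not r2))) => w g.
by split=> [/not_andP[] /contrapT|[h|h] []]; [left|right|..].
Qed.

Lemma rec_exists_fin V (I : finType) (P : I -> seq A -> (V -> nat) -> Prop) :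
  (forall i, recognisable (P i)) -> recognisable (fun w g => exists i, P i w g).
Proof.
move=> rP; have h (s : seq I) : recognisable (fun w g => exists2 i, i \in s & P i w g).
  elim: s => [|i s IH].
    by apply: rec_ext (rec_const V False) => w g; split=> // -[].
  apply: rec_ext (rec_or (rP i) IH) => w g; split.
    by case=> [Pi|[j js Pj]]; [exists i|exists j]; rewrite // inE ?eqxx ?js ?orbT.
  by case=> j; rewrite inE => /orP[/eqP->|js] Pj; [left|right; exists j].
apply: rec_ext (h (enum I)) => w g; split=> -[i]; first by exists i.
by exists i; rewrite ?mem_enum.
Qed.

Lemma rec_subst V V' (r : V -> V') (P : seq A -> (V -> nat) -> Prop) :
  recognisable P -> recognisable (fun w g => P w (g \o r)).
Proof.
move=> [M [op [e [f [F [am PF]]]]]].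
exists M, op, e, (fun a nu => f a (nu \o r)), F; split=> // w g; rewrite PF.
suff -> : run op e f 0 w (g \o r) = run op e (fun a nu => f a (nu \o r)) 0 w g by [].
by elim: w (0) => [//|a w IH] k /=; rewrite IH.
Qed.

Lemma rec_map B V (h : A -> B) (P : seq B -> (V -> nat) -> Prop) :
  recognisable P -> recognisable (fun w g => P (map h w) g).
Proof.
move=> [M [op [e [f [F [am PF]]]]]].
exists M, op, e, (fun a => f (h a)), F; split=> // w g; rewrite PF.
suff -> : run op e f 0 (map h w) g = run op e (fun a => f (h a)) 0 w g by [].
by elim: w (0) => [//|a w IH] k /=; rewrite IH.
Qed.

Lemma rec_letter V (p : pred A) (u : V) :
  recognisable (fun w g => oapp p false (onth w (g u))).
Proof.
pose f a (nu : pred V) := nu u && p a.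
exists bool, orb, false, f, id; split.
  apply: aperiodic_full; [exact: orbA|exact: orFb|exact: orbF|].
  by move=> x; exists 1; case: x.
suff h k w g : run orb false f k w g = (k <= g u) && oapp p false (onth w (g u - k)).
  by move=> w g; rewrite h subn0.
elim: w k => [|a w IH] k /=; first by rewrite onth0n andbF.
rewrite IH /f; case: (ltngtP k (g u)) => //= [kg|<-]; last by rewrite subnn orbF.
by rewrite -(subnSK kg).
Qed.

Lemma rec_le V (u v : V) :
  recognisable (fun (w : seq A) g => g u <= g v < size w).
Proof.
(* The bits record whether [u] occurs, whether [v] occurs, and whether [u] occurs no later than
   [v]. *)
pose op (x y : bool * bool * bool) :=
  (x.1.1 || y.1.1, x.1.2 || y.1.2, [|| x.2, y.2 | x.1.1 && y.1.2]).
pose f (a : A) (nu : pred V) := (nu u, nu v, nu u && nu v).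
exists (bool * bool * bool)%type, op, (false, false, false), f, (fun x => x.2); split.
  apply: aperiodic_full.
  - by do 3![case=> [[[] []] []]].
  - by case=> [[[] []] []].
  - by case=> [[[] []] []].
  - by move=> x; exists 2; case: x => [[[] []] []].
suff h k w g : run op (false, false, false) f k w g =
    (k <= g u < k + size w, k <= g v < k + size w, (k <= g u) && (g u <= g v < k + size w)).
  by move=> w g; rewrite h.
elim: w k => [|a w IH] k /=; first by congr (_, _, _); lia.
by rewrite IH /op /f /=; congr (_, _, _); lia.
Qed.

(* Once the position marked [u] has been read, the stop bit freezes the value. *)
Lemma rec_prefix V (u : V) (P : seq A -> (V -> nat) -> Prop) :
  recognisable P -> recognisable (fun w g => P (take (g u).+1 w) g).
Proof.
move=> [M [op [e [f [F [am PF]]]]]].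
pose op' (x y : bool * M) := if x.1 then x else (y.1, op x.2 y.2).
pose f' a (nu : pred V) := (nu u, f a nu).
exists (bool * M)%type, op', (false, e), f', (fun x => F x.2); split.
  apply: aperiodic_full.
  - by case=> [[] x] [[] y] [[] z]; rewrite /op' //= (amA am) ?inE.
  - by case=> [b x]; rewrite /op' /= (am1l am) ?inE.
  - by case=> [[] x]; rewrite /op' //= (am1r am) ?inE.
  case=> [[] x]; first by exists 1.
  have [n h] := am_aper am (in_setT x); exists n.
  have pE m : mpow op' (false, e) (false, x) m = (false, mpow op e x m).
    by elim: m => [//|m /= ->].
  by rewrite !pE h.
move=> w g; rewrite PF.
suff h k : k <= g u -> (run op' (false, e) f' k w g).2 = run op e f k (take ((g u).+1 - k) w) g.
  by rewrite h // subn0.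
elim: w k => [//|a w IH] k kg /=; rewrite subSn //= /op' /=.
case: (ltngtP k (g u)) kg => // [kg _|<- _] /=; last by rewrite subnn take0 /= (am1r am) ?inE.
by rewrite IH // subSS.
Qed.

Lemma oapp_marks V (g : V -> nat) j k :
  (fun o => oapp g j o == k) = oapp (fun v => g v == k) (j == k).
Proof. by apply: funext => -[]. Qed.

(* Schützenberger product: the second component collects the values obtained by marking
   one position. *)
Lemma rec_exists V (P : seq A -> (option V -> nat) -> Prop) :
  recognisable P -> recognisable (fun w g => exists2 j, j < size w & P w (oapp g j)).
Proof.
move=> [M [op [e [f [F [am PF]]]]]].
have opA x y z : op x (op y z) = op (op x y) z by apply: (amA am); rewrite inE.
have op1l x : op e x = x by apply: (am1l am); rewrite inE.
have op1r x : op x e = x by apply: (am1r am); rewrite inE.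
(* The mark lies in one of the two factors; the other is read unmarked. *)
pose op' (x y : M * {set M}) :=
  (op x.1 y.1, [set op x.1 t | t in y.2] :|: [set op s y.1 | s in x.2]).
pose f' a (nu : pred V) := (f a (oapp nu false), [set f a (oapp nu true)]).
have op'P (x y : M * {set M}) t : reflect
    ((exists2 s, s \in y.2 & t = op x.1 s) \/ (exists2 s, s \in x.2 & t = op s y.1))
    (t \in (op' x y).2).
  rewrite inE; apply: (iffP orP) => -[] h; [left|right|left|right].
  - by case/imsetP: h => s; exists s.
  - by case/imsetP: h => s; exists s.
  - by apply/imsetP; case: h => s; exists s.
  - by apply/imsetP; case: h => s; exists s.
exists (M * {set M})%type, op', (e, set0), f', (fun x : M * {set M} => [exists y in x.2, F y]); split.
  apply: aperiodic_full.
  - move=> x y z; congr (_, _); first exact: opA.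
    apply/setP=> t; apply/op'P/op'P.
      case=> -[s].
        case/op'P=> -[r ry ->] ->; first by left; exists r; rewrite // opA.
        by right; exists (op x.1 r); rewrite ?opA //; apply/op'P; left; exists r.
      by move=> sx ->; right; exists (op s y.1); rewrite ?opA //; apply/op'P; right; exists s.
    case=> -[s]; last case/op'P=> -[r ry ->] ->.
    - by move=> sz ->; left; exists (op y.1 s); rewrite ?opA //; apply/op'P; left; exists s.
    - by left; exists (op r z.1); rewrite ?opA //; apply/op'P; right; exists r.
    - by right; exists r; rewrite ?opA.
  - move=> [x X]; congr (_, _); first exact: op1l.
    apply/setP=> t; apply/op'P/idP; last by move=> tX; left; exists t; rewrite ?op1l.
    by case=> -[s] /=; [move=> sX ->; rewrite op1l|rewrite inE].
  - move=> [x X]; congr (_, _); first exact: op1r.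
    apply/setP=> t; apply/op'P/idP; last by move=> tX; right; exists t; rewrite ?op1r.
    by case=> -[s] /=; [rewrite inE|move=> sX ->; rewrite op1r].
  move=> [x X]; have [n hn] := am_aper am (in_setT x).
  have st k : n <= k -> mpow op e x k = mpow op e x k.+1 by move=> nk; apply: mpow_stable hn.
  have p1 k : (mpow op' (e, set0) (x, X) k).1 = mpow op e x k.
    by elim: k => [//|k /= ->].
  (* One of the [k] factors is marked, with [i] unmarked ones before it and [j] after it. *)
  have p2 k t : t \in (mpow op' (e, set0) (x, X) k).2 <->
      exists i j s, [/\ i + j.+1 = k, s \in X & t = op (mpow op e x i) (op s (mpow op e x j))].
    elim: k t => [|k IH] t.
      by rewrite inE; split=> // -[i [j [s []]]]; rewrite addnS.
    split.
      case/op'P=> -[s]; rewrite /= ?p1.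
        move/IH=> [i [j [r [<- rX ->]]]] ->; exists i.+1, j, r; split=> //=.
      by move=> sX ->; exists 0, k, s; rewrite op1l.
    case=> -[|i] [j [s [ij sX ->]]]; case: ij => ij; apply/op'P.
      by right; exists s; rewrite // p1 op1l ij.
    left; exists (op (mpow op e x i) (op s (mpow op e x j))); last by rewrite /= -opA.
    by apply/IH; exists i, j, s.
  (* With [2n + 1] factors one side of the marked one has at least [n], so a factor can be added
     there; with [2n + 2] one side has more than [n], so one can be removed. *)
  exists (n + n).+1; rewrite [LHS]surjective_pairing [RHS]surjective_pairing.
  congr (_, _); first by rewrite !p1; apply: st; lia.
  apply/setP=> t; apply/idP/idP=> /p2 [i [j [s [ij sX ->]]]]; apply/p2.
    have [ni|ni] := leqP n i.
      by exists i.+1, j, s; rewrite -st //; split=> //; lia.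
    by exists i, j.+1, s; rewrite -(st j); [split=> //|]; lia.
  have [ni|ni] := ltnP n i.
    by exists i.-1, j, s; rewrite (st i.-1) ?prednK; try split=> //; lia.
  by exists i, j.-1, s; rewrite (st j.-1) ?prednK; try split=> //; lia.
have out j k w g : j < k \/ k + size w <= j ->
    run op e f k w (oapp g j) = (run op' (e, set0) f' k w g).1.
  elim: w k => [//|a w IH] k /= h; rewrite IH; last by lia.
  congr (op (f a _) _); rewrite oapp_marks; have -> // : (j == k) = false by lia.
have mark w g k t : t \in (run op' (e, set0) f' k w g).2 <->
    exists2 j, k <= j < k + size w & t = run op e f k w (oapp g j).
  elim: w k t => [|a w IH] k t; first by rewrite inE; split=> // -[j]; rewrite /= addn0; lia.
  split.
    case/op'P=> -[s] /=.
      case/IH=> j jk -> ->; exists j; first lia.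
      by rewrite oapp_marks; have -> // : (j == k) = false by lia.
    rewrite inE => /eqP-> ->; exists k; first lia.
    by rewrite oapp_marks eqxx out //; left.
  case=> j jk tE; apply/op'P; rewrite /= oapp_marks in jk tE; rewrite tE.
  have [->|jnk] := eqVneq j k.
    right; exists (f a (oapp (fun v => g v == k) true)); first by rewrite /= inE.
    by rewrite out //; left.
  left; exists (run op e f k.+1 w (oapp g j)) => //.
  by apply/IH; exists j => //; lia.
move=> w g; split.
  case=> j jw /PF Fj; apply/exists_inP; exists (run op e f 0 w (oapp g j)) => //.
  by apply/mark; exists j.
by case/exists_inP=> t /mark[j jw ->] /PF Pj; exists j.
Qed.

End Closure.

(** * Traces and finitary CTL* *)

Section Kripke.
Variable AP : finType.
Implicit Types (K : kripke AP) (phi psi : cform AP).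

(** Left-totality extends every finite path to an infinite one. *)
Lemma traceP K (rho : seq (kst K)) :
  trace rho <-> exists s v, rho = s :: v /\ path (@kdelta AP K) s v.
Proof.
split.
  case=> rho_gt0 [f [fP rhoE]].
  exists (f 0), (map f (iota 1 (size rho).-1)); split.
    by rewrite [LHS]rhoE -[in LHS](prednK rho_gt0).
  elim: (size rho).-1 (0) => [//|n IH] k /=; rewrite IH andbT; exact: fP.
move=> [s [v [-> sv]]]; split=> //.
suff [f [fP f0 fE]] : exists f, [/\ inf_path f, f 0 = s & s :: v = mkseq f (size v).+1].
  by exists f.
elim: v s sv => [|t v IH] s /=.
  pose nx t := xchoose (@kdelta_total AP K t) => _.
  by exists (fun n => iter n nx s); split=> // n; apply: (xchooseP (kdelta_total _)).
case/andP=> st /IH [f [fP f0 fE]]; exists (fun n => if n is n'.+1 then f n' else s).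
split=> //; first by case=> [|n]; [rewrite f0|apply: fP].
by rewrite fE /mkseq /= -[in RHS](addn1 1) iotaDl -map_comp.
Qed.

Lemma trace_cat K (u v : seq (kst K)) s :
  trace (u ++ s :: v) <-> trace (rcons u s) /\ trace (s :: v).
Proof.
case: u => [|t u] /=.
  split=> [sv|[]//]; split=> //; apply/traceP; exists s, [::].
  by split.
split.
  case/traceP=> _ [_ [[<- <-]]]; rewrite -cat_rcons cat_path last_rcons => /andP[us sv].
  by split; apply/traceP; [exists t, (rcons u s)|exists s, v].
case=> /traceP[_ [_ [[<- <-] us]]] /traceP[_ [_ [[<- <-] sv]]]; apply/traceP.
by exists t, (u ++ s :: v); rewrite -cat_rcons cat_path last_rcons us.
Qed.

(** CTL* has no past operators, so only the suffix from the current position counts. *)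
Lemma csat_drop K (rho : seq (kst K)) i j phi :
  csat (drop i rho) j phi <-> csat rho (i + j) phi.
Proof.
have at_drop k : at_pos (drop i rho) k = at_pos rho (i + k) by rewrite /at_pos nth_drop.
have lt_drop k : k < size (drop i rho) <-> i + k < size rho.
  by rewrite size_drop; split; lia.
elim: phi j => [|p|a IH|a IHa b IHb|a IH|a IHa b IHb|a IH] j //=.
- by rewrite at_drop.
- by rewrite IH.
- by rewrite IHa IHb.
- by rewrite lt_drop IH addnS.
- split=> [[k [jk /lt_drop kl /IHb bk ak]]|[k [jk kl bk ak]]].
    exists (i + k); split=> //; first by rewrite leq_add2l.
    move=> l jl lk; have -> : l = i + (l - i) by lia.
    by apply/IHa/ak; lia.
  exists (k - i); split; [lia|by apply/lt_drop; lia|apply/IHb; rewrite subnKC //; lia|].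
  by move=> l jl lk; apply/IHa/ak; lia.
- by rewrite at_drop.
Qed.

Definition cOr phi psi := CNot (CAnd (CNot phi) (CNot psi)).

Lemma csat_or K (rho : seq (kst K)) i phi psi :
  csat rho i (cOr phi psi) <-> csat rho i phi \/ csat rho i psi.
Proof. by split=> [/not_andP[] /contrapT|[h|h] []]; [left|right|..]. Qed.

Definition cConst (Q : Prop) : cform AP := if `[< Q >] then CTop AP else CNot (CTop AP).

Lemma csat_const K (rho : seq (kst K)) i Q : csat rho i (cConst Q) <-> Q.
Proof. by rewrite /cConst; case: asboolP => //= nQ; split=> // /(_ I). Qed.

Definition cBigOr (I : finType) (F : I -> cform AP) :=
  foldr (fun x => cOr (F x)) (cConst False) (enum I).

Lemma csat_bigor K (rho : seq (kst K)) i (I : finType) (F : I -> cform AP) :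
  csat rho i (cBigOr F) <-> exists x, csat rho i (F x).
Proof.
suff h (s : seq I) : csat rho i (foldr (fun x => cOr (F x)) (cConst False) s) <->
    exists2 x, x \in s & csat rho i (F x).
  by rewrite h; split=> -[x]; exists x; rewrite ?mem_enum.
elim: s => [|x s IH]; first by rewrite csat_const; split=> // -[].
rewrite csat_or IH; split=> [[Fx|[y ys Fy]]|[y]].
- by exists x; rewrite ?mem_head.
- by exists y; rewrite // inE ys orbT.
by rewrite inE => /orP[/eqP->|ys Fy]; [left|right; exists y].
Qed.

(** * State labellings *)

(* Letters abstract states; each is defined by a CTL* formula depending on the current
   state only. *)
Record labelling := Labelling {
  letter : finType;
  lab : forall K : kripke AP, kst K -> letter;
  chi : letter -> cform AP;
  chiP : forall K (rho : seq (kst K)) i a,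
    csat rho i (chi a) <-> lab (at_pos rho i) = a
}.

Definition state_formula phi := forall K (rho : seq (kst K)) i,
  csat rho i phi <-> csat [:: at_pos rho i] 0 phi.

Section Family.
Variables (I : finType) (theta : I -> cform AP).
Hypothesis thetaP : forall x, state_formula (theta x).

Definition family_lab K (s : kst K) : {ffun I -> bool} :=
  [ffun x => `[< csat [:: s] 0 (theta x) >]].

(** A conjunction of literals fixing the truth value of every [theta x], written as a negated
    disjunction. *)
Definition family_chi (a : {ffun I -> bool}) :=
  CNot (cBigOr (fun x => if a x then CNot (theta x) else theta x)).

Lemma family_chiP K (rho : seq (kst K)) i a :
  csat rho i (family_chi a) <-> family_lab (at_pos rho i) = a.
Proof.
rewrite /= csat_bigor -forallNP; split=> [h|<- x].
  apply/ffunP => x; rewrite ffunE; have := h x; have [th ht] := thetaP x rho i.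
  case: (a x) => /= h1; first by apply/asboolP; apply: th; apply: contrapT.
  by apply/negbTE/asboolPn => /ht.
by rewrite ffunE; have [th ht] := thetaP x rho i; case: asboolP => [/ht h /(_ h)|h /th /h].
Qed.

Definition family_labelling := Labelling family_chiP.
End Family.

Section Product.
Variables L1 L2 : labelling.

Definition prod_lab K (s : kst K) := (lab L1 s, lab L2 s).

Lemma prod_chiP K (rho : seq (kst K)) i (a : letter L1 * letter L2) :
  csat rho i (CAnd (chi a.1) (chi a.2)) <->
  prod_lab (at_pos rho i) = a.
Proof. by case: a => a b /=; rewrite !chiP; split=> [[<- <-]|[<- <-]]. Qed.

Definition prod_labelling := @Labelling (letter L1 * letter L2)%type prod_lab _ prod_chiP.
End Product.

(** * Temporal languages as CTL* formulas *)

Lemma untilP (A : finType) (L1 L2 : seq A -> Prop) w :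
  until L1 L2 w <-> exists j, [/\ j <= size w, L2 (drop j w) &
                                  forall k, k < j -> L1 (drop k w)].
Proof.
elim: w => [|a w IH] /=.
  by split=> [h|[j []]]; [exists 0|rewrite leqn0 => /eqP->].
rewrite IH; split.
  case=> [h|[h [j [jw h2 h1]]]]; first by exists 0; rewrite ?drop0.
  by exists j.+1; split=> // -[|k] //; apply: h1.
case=> -[|j] [jw h2 h1]; first by left.
right; split; first exact: (h1 0).
by exists j; split=> // k; apply: (h1 k.+1).
Qed.

(** The operators translate one by one, but on words they may reach the empty suffix, where there is
    no position; membership of the empty word is then inserted as a constant. *)
Lemma ltl_cform (L : labelling) (Q : seq (letter L) -> Prop) : ltl Q ->
  exists phi, forall K (rho : seq (kst K)) i, i < size rho ->
    csat rho i phi <-> Q (map (@lab L K) (drop i rho)).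
Proof.
elim=> {Q} [P|Q _ [phi IH]|Q1 Q2 _ [phi1 IH1] _ [phi2 IH2]|
  Q _ [phi IH]|Q1 Q2 _ [phi1 IH1] _ [phi2 IH2]].
- exists (cBigOr (fun a => if P a then chi a else cConst False)) => K rho i il.
  rewrite csat_bigor (drop_nth (ks0 K) il) /= -/(at_pos rho i); split.
    case=> a; case: ifP => [Pa /chiP-> //|_ /csat_const[]].
  by move=> Pa; exists (lab L (at_pos rho i)); rewrite Pa chiP.
- by exists (CNot phi) => K rho i il /=; rewrite IH.
- by exists (CAnd phi1 phi2) => K rho i il /=; rewrite IH1 ?IH2.
- exists (cOr (CX phi) (CAnd (CNot (CX (CTop AP))) (cConst (Q [::])))) => K rho i il.
  rewrite csat_or [csat _ _ (CAnd _ _)]/= csat_const (drop_nth (ks0 K) il) /=.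
  split=> [[[il' /IH h]|[il' Q0]]|Qi].
  - exact: h.
  - by rewrite drop_oversize // leqNgt; apply/negP => il''; apply: il'.
  - have [il'|li] := ltnP i.+1 (size rho); first by left; rewrite IH.
    right; split; first by case; lia.
    by move: Qi; rewrite drop_oversize.
(* The second disjunct covers an until fulfilled at the empty suffix: [phi1] then holds at all
   remaining positions. *)
- exists (cOr (CU phi1 phi2) (CAnd (cConst (Q2 [::])) (CNot (CU (CTop AP) (CNot phi1))))).
  move=> K rho i il; rewrite csat_or [csat _ _ (CAnd _ _)]/= csat_const untilP.
  have dropE k : drop k (map (@lab L K) (drop i rho)) = map (@lab L K) (drop (i + k) rho).
    by rewrite -map_drop drop_drop addnC.
  rewrite size_map size_drop; split.
    case=> [[j [ij jl /IH2 h2 h1]]|[h2 h1]].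
      exists (j - i); split; first lia.
        by rewrite dropE subnKC //; apply: h2.
      by move=> k kj; rewrite dropE -IH1; [apply: h1|]; lia.
    exists (size rho - i); split=> //.
      by rewrite dropE subnKC ?drop_size //; lia.
    move=> k kl; rewrite dropE -IH1; last lia.
    apply: contrapT => n1; apply: h1; exists (i + k); split=> //; lia.
  case=> j [jl h2 h1]; have h1' k : i <= k -> k < i + j -> csat rho k phi1.
    by move=> ik kj; rewrite IH1; last lia; have := h1 (k - i); rewrite dropE subnKC //; apply; lia.
  have [ij|ji] := ltnP (i + j) (size rho).
    by left; exists (i + j); split=> //; [lia|rewrite IH2 // -dropE].
  right; split; first by move: h2; rewrite dropE drop_oversize.
  by case=> k [ik kl n1 _]; apply/n1/h1'; lia.
Qed.

(** A finite disjunction over the first letter and the value of the rest. The first letter is kept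
    apart because its position may carry marks. *)
Lemma aperiodic_suffix_cform (L : labelling) (M : finType) op (e : M)
    (h : letter L -> M) (P : letter L -> pred M) :
  aperiodic_monoid [set: M] op e ->
  exists phi, forall K s (v : seq (kst K)),
    csat (s :: v) 0 phi <-> P (lab L s) (mprod op e h (map (@lab L K) v)).
Proof.
move=> am.
have lm m : ltl (fun w => mprod op e h w = m).
  apply: ltl_ext (aperiodic_ltl (f := h) (B := setT) m am _) => [w|a]; last by rewrite inE.
  by split=> [[]//|hm]; split=> //; apply/allP => a; rewrite inE.
pose X (x : letter L * M) w :=
  P x.1 x.2 /\ (head_in (pred1 x.1) w /\ next (fun v => mprod op e h v = x.2) w).
have /ltl_cform[phi phiP] : ltl (fun w => exists x, X x w).
  apply: ltl_exists => x; apply: ltl_and (ltl_const _ _) _.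
  exact: ltl_and (ltl_head _) (ltl_next (lm _)).
exists phi => K s v; rewrite phiP // drop0 /X /=; split.
  by case=> -[a m] /= [Pam [/eqP-> ->]].
by move=> Pm; exists (lab L s, mprod op e h (map (@lab L K) v)).
Qed.

End Kripke.

Lemma rec_lt (A V : Type) (u v : V) :
  recognisable (fun (w : seq A) g => g u < g v < size w).
Proof. by apply: rec_ext (rec_and (rec_le A u v) (rec_not (rec_le A v u))) => w g; lia. Qed.

(** The successor is defined from the order: no position lies strictly in between. *)
Lemma rec_succ (A V : Type) (u v : V) :
  recognisable (fun (w : seq A) g => g v = (g u).+1 /\ g v < size w).
Proof.
have r := rec_exists (rec_and (rec_lt A (Some u) None) (rec_lt A None (Some v))).
apply: rec_ext (rec_and (rec_lt A u v) (rec_not r)) => w g /=; split; last first.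
  by move=> [-> vw]; split; [lia|case=> j; lia].
case=> uv nj; split; last lia.
have [//|uv1] := eqVneq (g v) (g u).+1.
by case: nj; exists (g u).+1; lia.
Qed.

(** * Predicates definable by hybrid formulas *)

Section Definability.
Variable AP : finType.
Implicit Types (K : kripke AP).

Definition hpred := forall K, seq (kst K) -> (nat -> nat) -> nat -> Prop.

(* The current position is the variable [None]. *)
Definition definable (P : hpred) := exists (L : labelling AP) Q, recognisable Q /\
  forall K rho g i, initial_trace rho -> i < size rho ->
    P K rho g i <-> Q (map (@lab _ L K) rho) (oapp g i).

Lemma def_ext (P P' : hpred) :
  (forall K rho g i, initial_trace rho -> i < size rho ->
    P K rho g i <-> P' K rho g i) -> definable P -> definable P'.
Proof.
move=> PP' [L [Q [rQ PQ]]]; exists L, Q; split=> // K rho g i ini il.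
by rewrite -PP' ?PQ.
Qed.

Lemma def_common (P1 P2 : hpred) : definable P1 -> definable P2 ->
  exists (L : labelling AP) Q1 Q2, [/\ recognisable Q1, recognisable Q2 &
  forall K rho g i, initial_trace rho -> i < size rho ->
    (P1 K rho g i <-> Q1 (map (@lab _ L K) rho) (oapp g i)) /\
    (P2 K rho g i <-> Q2 (map (@lab _ L K) rho) (oapp g i))].
Proof.
move=> [L1 [Q1 [r1 PQ1]]] [L2 [Q2 [r2 PQ2]]].
exists (prod_labelling L1 L2), (fun w g => Q1 (map fst w) g), (fun w g => Q2 (map snd w) g).
split; [exact: (@rec_map (letter L1 * letter L2)%type)|
  exact: (@rec_map (letter L1 * letter L2)%type)|] => K rho g i ini il.
by rewrite -!map_comp PQ1 // PQ2.
Qed.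

Lemma def_top : definable (fun _ _ _ _ => True).
Proof.
(* The empty family gives the labelling with a single letter. *)
exists (family_labelling (theta := fun x : void => CTop AP) (fun=> fun _ _ _ => iff_refl _)).
by exists (fun _ _ => True); split=> //; apply: rec_const.
Qed.

Lemma def_atom (p : AP) : definable (fun K rho _ i => p \in kmu (at_pos rho i)).
Proof.
pose L := family_labelling (theta := fun x : unit => CAtom p) (fun=> fun _ _ _ => iff_refl _).
exists L, (fun w g => is_true (oapp (fun a : letter L => a tt : bool) false (onth w (g None)))).
split=> [|K rho g i _ il]; first exact: rec_letter.
have -> : onth [seq lab L s | s <- rho] i = Some (lab L (at_pos rho i)).
  by rewrite onthE (nth_map (lab L (ks0 K))) ?size_map // (nth_map (ks0 K)).
by rewrite /= ffunE; split=> /asboolP.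
Qed.

Lemma def_var x : definable (fun K _ g i => g x = i).
Proof.
have [L [_ _]] := def_top; exists L.
exists (fun w g => g (Some x) <= g None < size w /\ g None <= g (Some x) < size w).
split=> [|K rho g i _ il]; first exact: rec_and (rec_le _ _ _) (rec_le _ _ _).
by rewrite /= size_map; lia.
Qed.

Lemma def_not P : definable P -> definable (fun K rho g i => ~ P K rho g i).
Proof.
move=> [L [Q [rQ PQ]]]; exists L, (fun w g => ~ Q w g); split; first exact: rec_not.
by move=> K rho g i ini il; rewrite PQ.
Qed.

Lemma def_or P1 P2 : definable P1 -> definable P2 ->
  definable (fun K rho g i => P1 K rho g i \/ P2 K rho g i).
Proof.
move=> d1 d2; have [L [Q1 [Q2 [r1 r2 PQ]]]] := def_common d1 d2.
exists L, (fun w g => Q1 w g \/ Q2 w g); split; first exact: rec_or.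
by move=> K rho g i ini il; have [-> ->] := PQ K rho g i ini il.
Qed.

(* [r] renames variables, [None] standing for the current position. *)
Lemma def_subst (r : nat -> option nat) P : definable P ->
  definable (fun K rho g i => P K rho (fun x => oapp g i (r x)) i).
Proof.
move=> [L [Q [rQ PQ]]]; exists L, (fun w g => Q w (g \o obind r)).
split=> [|K rho g i ini il]; first exact: rec_subst.
by rewrite PQ //; have -> : oapp g i \o obind r = oapp (fun x => oapp g i (r x)) i
  by apply: funext => -[].
Qed.

(** A quantifier names its position [None] and turns the former current position into [Some None].
    The renaming keeps the variables and makes the quantified position current; [move2] does so
    below two quantifiers. *)
Lemma move1 (g : option nat -> nat) j :
  oapp g j \o omap Some = oapp (g \o Some) j.
Proof. by apply: funext => -[]. Qed.

Lemma move2 (g : option nat -> nat) j k :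
  oapp (oapp g j) k \o omap (Some \o Some) = oapp (g \o Some) k.
Proof. by apply: funext => -[]. Qed.

Lemma def_next P : definable P ->
  definable (fun K rho g i => i.+1 < size rho /\ P K rho g i.+1).
Proof.
move=> [L [Q [rQ PQ]]].
have r := rec_exists (rec_and (rec_succ _ (Some None) None) (rec_subst (omap Some) rQ)).
exists L; eexists; split; first exact: r.
move=> K rho g i ini il /=; rewrite size_map; split.
  by case=> il' /PQ h; exists i.+1; rewrite // move1; split=> //; apply: h.
by case=> j _ [[-> il']]; rewrite move1 => h; split=> //; apply/PQ.
Qed.

Lemma def_prev P : definable P ->
  definable (fun K rho g i => 0 < i /\ P K rho g i.-1).
Proof.
move=> [L [Q [rQ PQ]]].
have r := rec_exists (rec_and (rec_succ _ None (Some None)) (rec_subst (omap Some) rQ)).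
exists L; eexists; split; first exact: r.
move=> K rho g i ini il /=; rewrite size_map; split.
  case=> i0 /PQ h; exists i.-1; first lia.
  by rewrite move1 prednK //; split=> //; apply: h => //; lia.
case=> j jl [[-> _]]; rewrite move1 => h; split=> //.
by apply/PQ.
Qed.

Lemma def_until P1 P2 : definable P1 -> definable P2 ->
  definable (fun K rho g i => exists j, [/\ i <= j, j < size rho, P2 K rho g j &
    forall k, i <= k -> k < j -> P1 K rho g k]).
Proof.
move=> d1 d2; have [L [Q1 [Q2 [r1 r2 PQ]]]] := def_common d1 d2.
(* Here [None] is [k], [Some None] is [j] and [Some (Some None)] is [i]: [P1] fails at some [k] with
   [i <= k < j]. *)
have bad := rec_exists (rec_and (rec_le _ (Some (Some None)) None)
  (rec_and (rec_lt _ None (Some None)) (rec_not (rec_subst (omap (Some \o Some)) r1)))).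
have r := rec_exists (rec_and (rec_le _ (Some None) None)
  (rec_and (rec_subst (omap Some) r2) (rec_not bad))).
exists L; eexists; split; first exact: r.
move=> K rho g i ini il /=; rewrite size_map; split.
  case=> j [ij jl h2 h1]; exists j => //; split; first by rewrite ij.
  split; first by rewrite move1; apply/(PQ K rho g j ini jl).2.
  case=> k kl [ik [kj n1]]; apply: n1; rewrite move2.
  by apply/(PQ K rho g k ini kl).1/h1; lia.
case=> j jl [ij []]; rewrite move1 => h2 nbad; exists j; split=> //; first lia.
  exact/(PQ K rho g j ini jl).2.
move=> k ik kj; apply: contrapT => n1; apply: nbad; have kl : k < size rho by lia.
exists k => //; split; first lia; split; first lia.
by rewrite move2 => /(PQ K rho g k ini kl).1.
Qed.

Lemma def_since P1 P2 : definable P1 -> definable P2 ->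
  definable (fun K rho g i => exists j, [/\ j <= i, P2 K rho g j &
    forall k, j < k -> k <= i -> P1 K rho g k]).
Proof.
move=> d1 d2; have [L [Q1 [Q2 [r1 r2 PQ]]]] := def_common d1 d2.
have bad := rec_exists (rec_and (rec_le _ None (Some (Some None)))
  (rec_and (rec_lt _ (Some None) None) (rec_not (rec_subst (omap (Some \o Some)) r1)))).
have r := rec_exists (rec_and (rec_le _ None (Some None))
  (rec_and (rec_subst (omap Some) r2) (rec_not bad))).
exists L; eexists; split; first exact: r.
move=> K rho g i ini il /=; rewrite size_map; split.
  case=> j [ij h2 h1]; have jl : j < size rho by lia.
  exists j => //; split; first by rewrite ij.
  split; first by rewrite move1; apply/(PQ K rho g j ini jl).2.
  case=> k kl [ik [kj n1]]; apply: n1; rewrite move2.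
  by apply/(PQ K rho g k ini kl).1/h1; lia.
case=> j jl [ij []]; rewrite move1 => h2 nbad; exists j; split=> //; first lia.
  exact/(PQ K rho g j ini jl).2.
move=> k ik kj; apply: contrapT => n1; apply: nbad; have kl : k < size rho by lia.
exists k => //; split; first lia; split; first lia.
by rewrite move2 => /(PQ K rho g k ini kl).1.
Qed.

(* The run splits at the current position: the value of the future part becomes a state
   formula, as no variable is bound there. *)
Lemma def_exists_f P : definable P ->
  definable (fun K rho g i => g 0 <= i /\ exists rho' : seq (kst K),
    [/\ initial_trace rho', take i.+1 rho' = take i.+1 rho &
        P K rho' (fun=> g 0) i]).
Proof.
move=> [L [Q [[M [op [e [f [F [am QF]]]]]] PQ]]].
pose h a := f a xpred0.
(* [phi m] says that a trace has value [m] after its first state; bit [m] of a letter of [LM] tells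
   whether some trace from the state satisfies it. *)
have /choice[phi phiP] : forall m, exists phi, forall K s (v : seq (kst K)),
    csat (s :: v) 0 phi <-> mprod op e h (map (@lab _ L K) v) == m.
  by move=> m; apply: (aperiodic_suffix_cform h (fun=> pred1 m) am).
pose LM := family_labelling (theta := fun m => CEf (phi m)) (fun m => fun _ _ _ => iff_refl _).
(* All variables are read as variable 0, the slot for the single free variable. *)
pose r (o : option nat) : option nat := if o is Some _ then Some 0 else None.
pose R m w (g : option nat -> nat) := F (op (run op e f 0 w (g \o r)) m).
have rR m : recognisable (R m).
  apply: (rec_subst r (P := fun w g => F (op (run op e f 0 w g) m))).
  by exists M, op, e, f, (fun x => F (op x m)).
pose L' := prod_labelling L LM.
(* Guess the value [m] of the continuation: the state at [i] must allow it, and the prefix up to [i]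
   completed by [m] must be accepted. *)
have rQ := rec_and (rec_le (letter L') (Some 0) None) (rec_exists_fin (fun m =>
  rec_and (rec_letter (fun a : letter L' => a.2 m) None)
    (rec_map (fst : letter L' -> letter L) (rec_prefix None (rR m))))).
exists L'; eexists; split; first exact: rQ.
move=> K rho g i ini il /=; rewrite size_map il andbT.
have -> : onth [seq lab L' s | s <- rho] i = Some (lab L' (at_pos rho i)).
  by rewrite onthE (nth_map (lab L' (ks0 K))) ?size_map // (nth_map (ks0 K)).
have [gi|] := leqP (g 0) i; last by split=> -[].
have rE : oapp g i \o r = oapp (fun=> g 0) i by apply: funext => -[].
(* Since [g 0 <= i], all marks lie in the kept prefix and the continuation is read unmarked. *)
have run_split v : Q (map (@lab _ L K) (take i.+1 rho ++ v)) (oapp (fun=> g 0) i) <->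
    R (mprod op e h (map (@lab _ L K) v)) (take i.+1 (map fst (map (@lab _ L' K) rho)))
      (oapp g i).
  rewrite QF map_cat run_cat // [X in F (op _ X) <-> _]run_unmarked.
    by rewrite /R rE -map_comp map_take.
  by move=> o; rewrite size_map size_takel //; case: o.
have takeE := take_nth (ks0 K) il; rewrite -/(at_pos rho i) in takeE.
set s := at_pos rho i in takeE *.
have trace_split v : trace (take i.+1 rho ++ v) <-> trace (s :: v).
  rewrite takeE cat_rcons trace_cat -takeE; split=> [[]//|sv]; split=> //.
  have := ini.1; rewrite -{1}(cat_take_drop i.+1 rho) takeE cat_rcons trace_cat -takeE.
  by case.
have bit m : family_lab (fun m => CEf (phi m)) s m <->
    exists2 v, trace (s :: v) & mprod op e h (map (@lab _ L K) v) = m.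
  rewrite ffunE; split=> [/asboolP[rho' [tr s0]]|[v tr vm]].
    have [t [v [vE _]]] := (traceP rho').1 tr; move: s0 tr; rewrite vE /at_pos /= => ->.
    by move=> tr /phiP /eqP vm; exists v.
  by apply/asboolP; exists (s :: v); split=> //; apply/phiP/eqP.
split.
  case=> _ [rho' [ini' tE]]; have rho'E : rho' = take i.+1 rho ++ drop i.+1 rho'.
    by rewrite -tE cat_take_drop.
  have il' : i < size rho'.
    by have := congr1 size tE; rewrite !size_take_min; lia.
  move/(PQ K rho' _ i ini' il'); rewrite rho'E => /run_split Rm; split=> //.
  exists (mprod op e h (map (@lab _ L K) (drop i.+1 rho'))); split=> //.
  apply/bit; exists (drop i.+1 rho') => //.
  by apply/trace_split; rewrite -rho'E; case: ini'.
case=> _ [m [/bit[v tr vm] Rm]]; split=> //; exists (take i.+1 rho ++ v).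
have ini' : initial_trace (take i.+1 rho ++ v).
  split; first exact/trace_split.
  by rewrite /at_pos nth_cat size_takel // nth_take //; case: ini.
split=> //; first by rewrite take_size_cat // size_takel.
apply/PQ => //; first by rewrite size_cat size_takel // ltn_addr.
by apply/run_split; rewrite vm.
Qed.

(** * From hybrid formulas to CTL* *)

Fixpoint hsize (phi : hform AP) : nat :=
  match phi with
  | HTop | HAtom _ | HVar _ => 1
  | HNot a | HX a | HXm a | HEf a | HBind _ a => (hsize a).+1
  | HOr a b | HU a b | HUm a b => (hsize a + hsize b).+1
  end.

Lemma hsat_fv K (rho : seq (kst K)) g g' i phi :
  {in fv phi, g =1 g'} -> hsat rho g i phi <-> hsat rho g' i phi.
Proof.
elim: phi rho g g' i => [|p|x|a IH|a IHa b IHb|x a IH|a IH|a IHa b IHb|a IH|a IHa b IHb|a IH]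
  rho g g' i gg' //=.
- by rewrite gg' ?mem_head.
- by rewrite (IH _ _ _ _ gg').
- by rewrite (IHa _ g g') ?(IHb _ g g') // => x xf; apply: gg'; rewrite mem_cat xf ?orbT.
- apply: IH => y ya; case: eqP => // /eqP yx; apply: gg'.
  by rewrite mem_filter yx.
- by rewrite (IH _ _ _ _ gg').
- have ha k := IHa rho g g' k (fun x xa => gg' x (mem_subseq (prefix_subseq _ _) xa)).
  have hb k := IHb rho g g' k (fun x xb => gg' x (mem_subseq (suffix_subseq _ _) xb)).
  by split=> -[j [ij jl /hb h2 h1]]; exists j; split=> // k ik kj; apply/ha/h1.
- by rewrite (IH _ _ _ _ gg').
- have ha k := IHa rho g g' k (fun x xa => gg' x (mem_subseq (prefix_subseq _ _) xa)).
  have hb k := IHb rho g g' k (fun x xb => gg' x (mem_subseq (suffix_subseq _ _) xb)).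
  by split=> -[j [ij /hb h2 h1]]; exists j; split=> // k ik kj; apply/ha/h1.
- by split=> -[rho' [ini tE /(IH _ _ _ _ gg') h]]; exists rho'.
Qed.

(** The nested pattern in [wf] matches only the guarded quantifier; every other negation reduces to
    [wf a]. *)
Lemma wf_not (a : hform AP) : wf (HNot a) -> wf a \/
  exists x psi, [/\ HNot a = hAnd (hFm (HVar _ x)) (HEf psi),
                    all (pred1 x) (fv psi) & wf psi].
Proof.
case: a => //=; try by left.
move=> b c; case: b; try by left.
case; try by left.
case; try by left.
case; try by left.
move=> x; case: c; try by left.
case; try by left.
by move=> psi /andP[fpsi wpsi]; right; exists x, psi.
Qed.

Lemma hsat_definable phi : wf phi -> definable (fun K rho g i => hsat rho g i phi).
Proof.
(* Induction on the size, because a guarded quantifier lies several constructors below its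
   negation. *)
have [n] := ubnP (hsize phi); elim: n phi => // n IH phi.
case: phi => [|p|x|a|a b|x a|a|a b|a|a b|a] sn /=.
- by move=> _; apply: def_top.
- by move=> _; apply: def_atom.
- by move=> _; apply: def_var.
- case/wf_not=> [wa|[x [psi [aE /allP fpsi wpsi]]]].
    by apply: def_not; apply: IH.
  have dpsi : definable (fun K rho g i => hsat rho g i psi).
    by apply: IH => //; case: aE sn => -> /=; lia.
  (* Slot 0 is filled with [x]; its guard [g x <= i] is the meaning of [F^- x]. *)
  apply: def_ext (def_subst (fun=> Some x) (def_exists_f dpsi)) => K rho g i ini il.
  have gx rho' : hsat rho' (fun=> g x) i psi <-> hsat rho' g i psi.
    by apply: hsat_fv => y /fpsi /eqP->.
  rewrite -[~ _]/(hsat rho g i (HNot a)) aE /=; split.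
    case=> gi [rho' [ini' tE /gx h]] [[]|[]]; last by exists rho'.
    by exists (g x).
  move=> h; split.
    by apply: contrapT => gi; apply: h; left=> -[j [ji gj _]]; apply: gi; rewrite gj.
  by apply: contrapT => ne; apply: h; right=> -[rho' [ini' tE /gx h]]; apply: ne; exists rho'.
- by case/andP=> wa wb; apply: def_or; apply: IH => //; move: sn => /=; lia.
- move=> wa; have da : definable (fun K rho g i => hsat rho g i a) by apply: IH.
  apply: def_ext (def_subst (fun y => if y == x then None else Some y) da) => K rho g i ini il.
  have -> // : (fun y => oapp g i (if y == x then None else Some y)) =
         (fun y => if y == x then i else g y).
  by apply: funext => y; case: eqP.
- by move=> wa; exact: def_next (IH a sn wa).
- by case/andP=> wa wb; apply: (def_until (IH a _ wa) (IH b _ wb)); move: sn => /=; lia.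
- by move=> wa; exact: def_prev (IH a sn wa).
- by case/andP=> wa wb; apply: (def_since (IH a _ wa) (IH b _ wb)); move: sn => /=; lia.
- case/andP=> fa wa; have da : definable (fun K rho g i => hsat rho g i a) by apply: IH.
  (* Without free variables the slot can be put at the current position, and the guard becomes
     [i <= i]. *)
  apply: def_ext (def_subst (fun=> None) (def_exists_f da)) => K rho g i ini il /=.
  have ga rho' : hsat rho' (fun=> i) i a <-> hsat rho' g i a.
    by apply: hsat_fv => y; rewrite (nilP fa).
  by split=> [[_ [rho' [? ? /ga]]]|[rho' [? ? /ga]]]; [|split=> //]; exists rho'.
Qed.

(** At position 0 with all variables 0, the first letter carries every mark and the rest of the
    trace none. *)
Lemma definable_cform P : definable P ->
  exists psi, forall K (rho : seq (kst K)), initial_trace rho ->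
    P K rho (fun=> 0) 0 <-> csat rho 0 psi.
Proof.
move=> [L [Q [[M [op [e [f [F [am QF]]]]]] PQ]]].
have [psi psiP] := aperiodic_suffix_cform (f^~ xpred0)
  (fun a m => F (op (f a xpredT) m)) am.
exists psi => K rho ini; have [s [v [rhoE _]]] := (traceP rho).1 ini.1.
rewrite PQ // ?rhoE //= psiP QF /= run_unmarked; last by case.
by have -> : (fun o : option nat => oapp (fun=> 0) 0 o == 0) = xpredT by apply: funext => -[].
Qed.

(** * From CTL* to hybrid formulas *)

Fixpoint hybrid (psi : cform AP) : hform AP :=
  match psi with
  | CTop => HTop AP
  | CAtom p => HAtom p
  | CNot a => HNot (hybrid a)
  | CAnd a b => hAnd (hybrid a) (hybrid b)
  | CX a => HX (hybrid a)
  | CU a b => HU (hybrid a) (hybrid b)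
  | CEf a => HEf (hybrid a)
  end.

Lemma fv_hybrid psi : fv (hybrid psi) = [::].
Proof. by elim: psi => //= a -> // b ->. Qed.

(** Translated formulas contain no variable, so the guarded pattern in [wf] never matches. *)
Lemma wf_hybrid psi : wf (hybrid psi).
Proof.
have wfN a : wf (HNot (hybrid a)) = wf (hybrid a) by case: a.
have wfA a b : wf (hybrid (CAnd a b)) = wf (HNot (hybrid a)) && wf (HNot (hybrid b)).
  by case: a.
elim: psi => [|p|a wa|a wa b wb|a wa|a wa b wb|a wa] //.
- by rewrite [hybrid _]/= wfN.
- by rewrite wfA !wfN wa.
- by rewrite /= wa.
- by rewrite /= fv_hybrid.
Qed.

(** The hybrid quantifier keeps the history that CTL* forgets: one direction drops the first [i]
    states of the witness, the other prepends those of [rho]. *)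
Lemma hsat_hybrid K (rho : seq (kst K)) g i psi :
  initial_trace rho -> i < size rho -> hsat rho g i (hybrid psi) <-> csat rho i psi.
Proof.
elim: psi rho i => [|p|a IH|a IHa b IHb|a IH|a IHa b IHb|a IH] rho i ini il //=.
- by rewrite IH.
- rewrite IHa ?IHb //; split=> [h|[ha hb] [/(_ ha)|/(_ hb)] //].
  by split; apply: contrapT => n; apply: h; [left|right].
- by split=> -[il' /IH h]; split=> //; apply: h.
- split=> -[j [ij jl /IHb h2 h1]]; exists j; split=> //; try exact: h2.
    by move=> k ik kj; apply/IHa => //; [lia|apply: h1].
  by move=> k ik kj; apply/IHa => //; [lia|apply: h1].
have takeE := cat_take_drop i rho; rewrite (drop_nth (ks0 K) il) -/(at_pos rho i) in takeE.
split.
  case=> rho' [ini' tE].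
  have il' : i < size rho' by have := congr1 size tE; rewrite !size_take_min; lia.
  move/(IH _ _ ini' il'); rewrite -[i in csat _ i]addn0 -csat_drop => h.
  have at_i : at_pos (drop i rho') 0 = at_pos rho i.
    by rewrite /at_pos nth_drop addn0 -(nth_take _ (ltnSn i)) tE nth_take.
  exists (drop i rho'); split=> //.
  have := ini'.1; rewrite -{1}(cat_take_drop i rho') (drop_nth (ks0 K) il').
  by case/trace_cat.
case=> rho' [tr s0 h]; have [t [v [vE _]]] := (traceP rho').1 tr.
have tE : t = at_pos rho i by rewrite -s0 vE.
have ini' : initial_trace (take i rho ++ rho').
  split.
    have := ini.1; rewrite -{1}takeE vE tE trace_cat => -[? _]; apply/trace_cat.
    by split=> //; rewrite -tE -vE.
  case: ini => _; rewrite /at_pos -{1}takeE !nth_cat vE tE.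
  by case: (size (take i rho)).
have size_t : size (take i rho) = i by rewrite size_takel // ltnW.
exists (take i rho ++ rho'); split=> //.
  by rewrite -{2}takeE vE tE -!cat_rcons !take_size_cat // size_rcons size_t.
apply/IH => //; first by rewrite size_cat size_t vE /= -addSnnS ltn_addr.
by rewrite -[i in csat _ i]addn0 -csat_drop -{1}size_t drop_size_cat.
Qed.

End Definability.

Theorem theorem4p15 (AP : finType) :
  (forall phi : hform AP, wf phi -> sentence phi ->
     exists psi : cform AP, forall K : kripke AP, hmodel K phi <-> cmodel K psi)
  /\
  (forall psi : cform AP,
     exists phi : hform AP, [/\ wf phi, sentence phi &
       forall K : kripke AP, hmodel K phi <-> cmodel K psi]).
Proof.
split=> [phi wphi _|psi].
  have [psi psiP] := definable_cform (hsat_definable wphi).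
  by exists psi => K; split=> h rho ini; apply/psiP => //; apply: h.
exists (hybrid psi); split; first exact: wf_hybrid.
  by rewrite /sentence fv_hybrid.
by move=> K; split=> h rho ini; have [[rho_gt0 _] _] := ini;
  apply/(hsat_hybrid (fun=> 0)) => //; apply: h.
Qed.
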